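(* Let $K$ be a proper cone in $\mathbb{R}^n$ and let $A\in\pi(K)$. Let $\Phi(x)$ be a vertex of the digraph $(\mathcal{E},\mathcal{P}(A,K))$ which is at a distance $w\ (\ge 0)$ to a circuit $\mathcal{C}$ of length $l$. Suppose that $A^l$ is $K$-irreducible, or that the circuit $\mathcal{C}$ contains a vertex $\Phi(u)$ for which $\gamma(A,u)$ is finite. Then $\gamma(A,x)$ is finite and $$\gamma(A,x)\le w+(m_{A^l}-1)l\le w+(m_A-1)l\le w+(n-1)l.$$
   Context: A proper cone $K$ in $\mathbb{R}^n$ is a closed convex cone that is pointed ($K\cap(-K)=\{0\}$) and has nonempty interior. A face of $K$ is a subcone $F\subseteq K$ such that $y\in F$ whenever $x\in F$ and $y,x-y\in K$; faces other than $\{0\}$ and $K$ are nontrivial. For $x\in K$, $\Phi(x)$ is the smallest face of $K$ containing $x$. A nonzero $x\in K$ is an extreme vector if $\Phi(x)=\{\lambda x:\lambda\ge0\}$, which is then an extreme ray. $\pi(K)$ is the set of $n\times n$ real matrices $A$ with $AK\subseteq K$. $A\in\pi(K)$ is $K$-irreducible if it leaves invariant no nontrivial face of $K$. For $A\in\pi(K)$ and $0\ne x\in K$, the local exponent $\gamma(A,x)$ is the smallest nonnegative integer $k$ with $A^kx\in\operatorname{int}K$, and $\gamma(A,x)=\infty$ if there is no such $k$. $m_C$ denotes the degree of the minimal polynomial of a square matrix $C$. For $A\in\pi(K)$, $(\mathcal{E},\mathcal{P}(A,K))$ is the (possibly infinite) digraph whose vertices are the extreme rays of $K$, with an arc $(\Phi(x),\Phi(y))$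 whenever $\Phi(y)\subseteq\Phi(Ax)$ (loops allowed). A circuit is a directed cycle with no repeated vertices, a loop being a circuit of length $1$. The distance from a vertex $v$ to a circuit is the length of a shortest directed path from $v$ to a vertex of the circuit (zero if $v$ lies on it). *)

(* Defs.v *)
(* Vectors of R^n are 'cV[R]_n over R : realType, with the
   topology of the matrix normed space.  The dimension is written n.+1 because
   square matrices form a nontrivial ring, and have a minimal polynomial in
   mxpoly, only in positive dimension. *)
From HB Require Import structures.
From mathcomp Require Import all_boot all_order all_algebra.
From mathcomp Require Import boolp classical_sets reals topology normedtype.

Set Implicit Arguments.
Unset Strict Implicit.
Unset Printing Implicit Defensive.
Import Order.TTheory GRing.Theory Num.Theory.
Import numFieldNormedType.Exports.
Local Open Scope classical_set_scope.
Local Open Scope ring_scope.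

Section Cones.
Variables (R : realType) (n : nat).
Implicit Types (K F E v : set 'cV[R]_n.+1) (A : 'M[R]_n.+1) (x y : 'cV[R]_n.+1).

(* Given the two closure properties, 0 \in F is just nonemptiness. *)
Definition convex_cone F : Prop :=
  [/\ F 0,
      forall x y, F x -> F y -> F (x + y) &
      forall (a : R) x, 0 <= a -> F x -> F (a *: x)].

Definition pointed K : Prop := K `&` [set - x | x in K] = [set 0].

Definition proper_cone K : Prop :=
  [/\ closed K, convex_cone K, pointed K & interior K !=set0].

Definition face K F : Prop :=
  [/\ convex_cone F, F `<=` K &
      forall x y, F x -> K y -> K (x - y) -> F y].

Definition nontrivial_face K F : Prop :=
  [/\ face K F, F <> [set 0] & F <> K].

Definition Phi K x : set 'cV[R]_n.+1 := smallest (face K) [set x].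

Definition extreme_vector K x : Prop :=
  [/\ K x, x <> 0 & Phi K x = [set a *: x | a in [set a : R | 0 <= a]]].

Definition cone_preserving K A : Prop := forall x, K x -> K (A *m x).

Definition K_irreducible K A : Prop :=
  cone_preserving K A /\
  forall F, nontrivial_face K F -> ~ (forall x, F x -> F (A *m x)).

(* [None] stands for an infinite local exponent. *)
Definition local_exponent K A x : option nat :=
  match pselect (exists k, `[< interior K (A ^+ k *m x) >]) with
  | left h => Some (ex_minn h)
  | right _ => None
  end.

(* Vertices are extreme rays, as sets of vectors; both ends of an arc are
   automatically vertices. *)
Definition arc K A : rel (set 'cV[R]_n.+1) := fun E F =>
  `[< exists x y,
        [/\ extreme_vector K x, extreme_vector K y,
            E = Phi K x, F = Phi K y & Phi K y `<=` Phi K (A *m x)] >].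

(* A circuit is the sequence of its pairwise distinct vertices; the closing arc
   from the last one back to the first is part of [cycle], so that [:: v] is a
   circuit iff there is a loop at v. *)
Definition circuit K A (c : seq (set 'cV[R]_n.+1)) (l : nat) : Prop :=
  [/\ c <> [::], ucycle (arc K A) c & size c = l].

Definition walk_to_circuit K A (c : seq (set 'cV[R]_n.+1)) v (w : nat) : Prop :=
  exists p, [/\ path (arc K A) v p, size p = w & last v p \in c].

Definition distance_to_circuit K A (c : seq (set 'cV[R]_n.+1)) v (w : nat) : Prop :=
  walk_to_circuit K A c v w /\
  forall w', walk_to_circuit K A c v w' -> (w <= w')%N.

End Cones.

(* Main.v *)
(* Order K by y <= z iff a z - y \in K for some a >= 0; for y, z in K this says
   Phi(y) `<=` Phi(z), it is preserved by A, and anything above an interior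
   vector is interior.  If y lies on the circuit then y <= B y with B = A ^+ l,
   so the vectors B^i y increase.  Since B^m y (m = m_B) is a linear combination
   of the B^i y with i < m, it is already below B^(m-1) y: the face of
   B^(m-1) y is B-invariant, and the sequence B^i y stops growing at i = m - 1.
   Either hypothesis then makes B^(m-1) y interior, and a walk of length w from
   x to y gives y <= A^w x. *)
Require Import Defs.
From HB Require Import structures.
From mathcomp Require Import all_boot all_order all_algebra.
From mathcomp Require Import boolp classical_sets reals topology normedtype.
Import Order.TTheory GRing.Theory Num.Theory.
Import numFieldNormedType.Exports.
Set Implicit Arguments.
Unset Strict Implicit.
Unset Printing Implicit Defensive.
Local Open Scope classical_set_scope.
Local Open Scope ring_scope.

(** * Matrix powers and the degree of the minimal polynomial *)

Lemma mulmx_exprD (R : realType) (n : nat) (A : 'M[R]_n.+1) (i j : nat)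
    (x : 'cV[R]_n.+1) : A ^+ (i + j) *m x = A ^+ i *m (A ^+ j *m x).
Proof. by rewrite exprD -mulmxE mulmxA. Qed.

(** The first powers of [B], as many as its degree, are linearly independent, and each is a
    polynomial in [A], hence lies in a space spanned by [degree_mxminpoly A] powers of [A]. *)
Lemma degree_mxminpoly_expr (F : fieldType) (n : nat) (A : 'M[F]_n.+1) (l : nat) :
  (degree_mxminpoly (A ^+ l) <= degree_mxminpoly A)%N.
Proof.
set B := A ^+ l.
rewrite -[leqLHS](eqnP (minpoly_mx_free B)).
apply: leq_trans (rank_leq_row (powers_mx A (degree_mxminpoly A))).
apply/mxrankS/row_subP => i; rewrite rowK /B -exprM.
by have := horner_mx_mem A 'X^(l * i); rewrite rmorphXn /= horner_mx_X.
Qed.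

Lemma degree_mxminpoly_le (F : fieldType) (n : nat) (A : 'M[F]_n.+1) :
  (degree_mxminpoly A <= n.+1)%N.
Proof.
rewrite -ltnS -size_mxminpoly -(size_char_poly A).
by rewrite dvdp_leq ?mxminpoly_dvd_char // monic_neq0 // char_poly_monic.
Qed.

Lemma mxpow_lin_comb (F : fieldType) (n : nat) (A : 'M[F]_n.+1) (k : nat) :
  exists u : 'I_(degree_mxminpoly A) -> F, A ^+ k = \sum_i u i *: A ^+ i.
Proof.
have := horner_mx_mem A 'X^k; rewrite rmorphXn /= horner_mx_X => /submxP[u hu].
exists (u 0); rewrite -[LHS]mxvecK hu mulmx_sum_row linear_sum /=.
by apply: eq_bigr => i _; rewrite linearZ /= rowK mxvecK.
Qed.

(** * The domination preorder of a convex cone *)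

Section Domination.
Variables (R : realType) (n : nat) (K : set 'cV[R]_n.+1).
Hypothesis coneK : convex_cone K.

Definition dominated (y z : 'cV[R]_n.+1) : Prop :=
  exists2 a : R, 0 <= a & K (a *: z - y).

Lemma cone0 : K 0. Proof. by case: coneK. Qed.

Lemma coneD x y : K x -> K y -> K (x + y).
Proof. by case: coneK => _ h _; apply: h. Qed.

Lemma coneZ (a : R) x : 0 <= a -> K x -> K (a *: x).
Proof. by case: coneK => _ _; apply. Qed.

Lemma dominated_refl y : dominated y y.
Proof. by exists 1; rewrite ?ler01 // scale1r subrr; apply: cone0. Qed.

Lemma dominated_trans z x y : dominated x z -> dominated z y -> dominated x y.
Proof.
move=> [a a0 Ka] [b b0 Kb]; exists (a * b); first exact: mulr_ge0.
rewrite -(subrK (a *: z) (_ *: _)) -scalerA -scalerBr -addrA.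
by apply: coneD => //; apply: coneZ.
Qed.

Lemma dominated_mulmx A y z :
  cone_preserving K A -> dominated y z -> dominated (A *m y) (A *m z).
Proof.
by move=> hA [a a0 /hA Ka]; exists a => //; rewrite linearB /= -scalemxAr in Ka.
Qed.

Lemma dominated_add x y z : dominated x z -> dominated y z -> dominated (x + y) z.
Proof.
move=> [a a0 Ka] [b b0 Kb]; exists (a + b); first exact: addr_ge0.
by rewrite scalerDl opprD addrACA; apply: coneD.
Qed.

(** The sign of [c] is free: for [c <= 0] the vector [- c *: y] is already in [K], so the witness 0
    works. This lets linear combinations with arbitrary coefficients be dominated. *)
Lemma dominated_scale (c : R) y z :
  K y -> dominated y z -> dominated (c *: y) z.
Proof.
move=> Ky [a a0 Ka]; have [c0|/ltW c0] := leP 0 c.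
  exists (c * a); first exact: mulr_ge0.
  by rewrite -scalerA -scalerBr; apply: coneZ.
exists 0; first by [].
by rewrite scale0r sub0r -scaleNr; apply: coneZ; rewrite // oppr_ge0.
Qed.

Lemma dominated_sum (I : finType) (c : I -> R) (f : I -> 'cV[R]_n.+1) z :
  (forall i, K (f i)) -> (forall i, dominated (f i) z) ->
  dominated (\sum_i c i *: f i) z.
Proof.
move=> Kf fz; apply: (big_ind (dominated^~ z)) => [|x y|i _].
- by exists 0 => //; rewrite scale0r subrr; apply: cone0.
- exact: dominated_add.
- exact: dominated_scale.
Qed.

(** * Domination and interior vectors *)

Lemma interior_normP x :
  interior K x <-> exists2 r : R, 0 < r & forall y, `|x - y| < r -> K y.
Proof.
split=> [/(@nbhs_normP R _ x K)[r r0 h]|[r r0 h]]; first by exists r.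
by apply/(@nbhs_normP R _ x K); exists r.
Qed.

Lemma interiorD x y : interior K x -> K y -> interior K (x + y).
Proof.
move=> /interior_normP[r r0 h] Ky; apply/interior_normP; exists r => // z hz.
rewrite -(subrK y z); apply: coneD => //; apply: h.
by rewrite opprB addrA.
Qed.

Lemma interiorZ (a : R) x : 0 < a -> interior K x -> interior K (a *: x).
Proof.
move=> a0 /interior_normP[r r0 h]; apply/interior_normP.
exists (a * r) => [|y hy]; first exact: mulr_gt0.
rewrite -[y](scalerKV (lt0r_neq0 a0)); apply: coneZ (ltW a0) _; apply: h.
rewrite -(ltr_pM2l a0) -{1}(gtr0_norm a0) -normrZ scalerBr.
by rewrite scalerKV // lt0r_neq0.
Qed.

Lemma dominated_interior y z :
  interior K y -> K z -> dominated y z -> interior K z.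
Proof.
(* Since [a] may be 0, one divides by [a + 1] instead: [(a + 1) *: z] is [y] plus the element
   [a *: z - y + z] of [K]. *)
move=> iy Kz [a a0 Ka]; have a1 : 0 < a + 1 by apply: ltr_wpDl.
rewrite -[z](scalerK (lt0r_neq0 a1)); apply: interiorZ; first by rewrite invr_gt0.
rewrite scalerDl scale1r -(subrK y (a *: z)) addrAC addrC.
by apply: interiorD => //; apply: coneD.
Qed.

Lemma interior_dominates z y : interior K z -> dominated y z.
Proof.
(* The scale [t] is chosen so that [t *: y] has norm less than [r], which puts [z - t *: y] in [K];
   the summand 1 covers [y = 0]. *)
move=> /interior_normP[r r0 h]; set t := r / (`|y| + 1).
have y1 : 0 < `|y| + 1 by apply: ltr_wpDl.
have t0 : 0 < t by apply: divr_gt0.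
exists t^-1; first by rewrite invr_ge0 ltW.
rewrite -[y](scalerK (lt0r_neq0 t0)) -scalerBr.
apply: coneZ; first by rewrite invr_ge0 ltW.
apply: h; rewrite opprB addrC subrK normrZ gtr0_norm // /t -mulrA gtr_pMr //.
by rewrite ltr_pdivrMl // mulr1 ltrDl.
Qed.

(** One vector of [K] sent into the interior is enough: [z] dominates [e], so [A *m z] dominates
    [A *m e]. *)
Lemma interior_mulmx A e z : cone_preserving K A ->
  K e -> interior K (A *m e) -> interior K z -> interior K (A *m z).
Proof.
move=> hA Ke iAe iz; apply: (dominated_interior iAe).
  by apply: hA; apply: interior_subset.
exact/dominated_mulmx/interior_dominates.
Qed.

(** * Generated faces in terms of domination *)

Lemma face_dominated z : K z -> face K [set y | K y /\ dominated y z].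
Proof.
move=> Kz; split.
- split=> /= [|x y [Kx xz] [Ky yz]|a x a0 [Kx xz]].
  + by split; [exact: cone0|exists 0 => //; rewrite scale0r subrr; apply: cone0].
  + by split; [exact: coneD|exact: dominated_add].
  + by split; [exact: coneZ|exact: dominated_scale].
- by move=> x [].
- move=> x y [_ [a a0 Ka]] Ky Kxy; split=> //; exists a => //.
  by rewrite -(subrK x (a *: z)) -addrA; apply: coneD.
Qed.

Lemma PhiE z : K z -> Phi K z = [set y | K y /\ dominated y z].
Proof.
move=> Kz; apply/seteqP; split.
  apply: smallest_sub; first exact: face_dominated.
  by move=> _ ->; split=> //; apply: dominated_refl.
move=> y [Ky [a a0 Ka]] F [[[_ _ FZ] _ Fface] zF].
by apply: Fface Ka => //; apply: FZ => //; apply: zF.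
Qed.

Lemma Phi_self z : Phi K z z.
Proof. by move=> F [_]; apply. Qed.

Lemma Phi_dominated y z : K z -> Phi K z y -> dominated y z.
Proof. by move=> Kz; rewrite PhiE // => -[]. Qed.

(** * Growth of the iterates of a vector dominated by its image *)

Lemma cone_preserving_exp A k : cone_preserving K A -> cone_preserving K (A ^+ k).
Proof.
move=> hA; elim: k => [|k IH] x Kx; first by rewrite expr0 mul1mx.
by rewrite exprS -mulmxE -mulmxA; apply/hA/IH.
Qed.

Lemma dominated_exp A i j y : cone_preserving K A ->
  dominated y (A *m y) -> (i <= j)%N -> dominated (A ^+ i *m y) (A ^+ j *m y).
Proof.
move=> hA yAy /subnK <-; elim: (j - i)%N => [|d IH]; first exact: dominated_refl.
apply: (dominated_trans IH).
rewrite addSn -(addn1 (d + i)) (mulmx_exprD A (d + i) 1) expr1.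
exact: dominated_mulmx (@cone_preserving_exp A (d + i) hA) yAy.
Qed.

Lemma dominated_last_power A k y : cone_preserving K A -> K y ->
  dominated y (A *m y) ->
  dominated (A ^+ k *m y) (A ^+ (degree_mxminpoly A - 1) *m y).
Proof.
move=> hA Ky yAy; have [u ->] := mxpow_lin_comb A k.
rewrite mulmx_suml.
under eq_bigr do rewrite -scalemxAl.
apply: dominated_sum => i; first exact: cone_preserving_exp.
apply: dominated_exp => //.
by rewrite -ltnS subn1 (ltn_predK (mxminpoly_nonconstant A)).
Qed.

Lemma interior_last_power A y : interior K !=set0 -> cone_preserving K A ->
  K y -> y <> 0 -> dominated y (A *m y) ->
  K_irreducible K A \/ (exists k, interior K (A ^+ k *m y)) ->
  interior K (A ^+ (degree_mxminpoly A - 1) *m y).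
Proof.
move=> [e ie] hA Ky y0 yAy; set z := A ^+ _ *m y.
have Kz : K z by apply: cone_preserving_exp.
case=> [[_ irrA]|[k ik]]; last first.
  exact: dominated_interior ik Kz (dominated_last_power _ hA Ky yAy).
have Fz := face_dominated Kz; set F := [set _ | _] in Fz.
(* The face [F] of [z] is invariant because [A *m z] is a further iterate of [y], hence still below
   [z]; it is nonzero because it contains [y]. Irreducibility leaves only [K]. *)
have FE : F = K.
  apply: contrapT => FK; apply: (irrA F); last first.
    move=> v [Kv vz]; split; first exact: hA.
    apply: dominated_trans (dominated_mulmx hA vz) _.
    rewrite /z mulmxA mulmxE -exprS.
    exact: dominated_last_power.
  split=> // F0; apply: y0; suff : F y by rewrite F0.
  split=> //; have := dominated_last_power 0 hA Ky yAy.
  by rewrite expr0 mul1mx.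
have : F e by rewrite FE; apply: interior_subset.
by move=> [_]; apply: dominated_interior.
Qed.

(** * Walks and circuits in the digraph *)

Lemma arcP A E F : Defs.arc K A E F -> exists x y, [/\ extreme_vector K x,
  extreme_vector K y, E = Phi K x, F = Phi K y & Phi K y `<=` Phi K (A *m x)].
Proof. by move/asboolP. Qed.

Lemma walk_dominated A x y p : cone_preserving K A -> K x ->
  path (Defs.arc K A) (Phi K x) p -> last (Phi K x) p = Phi K y ->
  dominated y (A ^+ size p *m x).
Proof.
move=> hA; elim: p x => [|F p IH] x Kx /=.
  move=> _ xy; rewrite expr0 mul1mx; apply: Phi_dominated => //.
  by rewrite xy; apply: Phi_self.
case/andP=> /arcP[x' [y' [[Kx' _ _] [Ky' _ _] xx' -> y'x']]] hp hl.
(* The arc may name another generator [x'] of the ray of [x]; equality of the two faces puts [x']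
   below [x], and [y'] is below [A *m x']. *)
apply: dominated_trans (IH _ Ky' hp hl) _.
rewrite -(addn1 (size p)) mulmx_exprD expr1.
apply: dominated_mulmx; first exact: cone_preserving_exp.
apply: (@dominated_trans (A *m x')).
  by apply: Phi_dominated; [exact: hA|apply: y'x'; exact: Phi_self].
apply: dominated_mulmx => //.
by apply: Phi_dominated => //; rewrite xx'; apply: Phi_self.
Qed.

(** Rotating the circuit so that it starts at [E] turns it into a closed walk with [l] arcs. *)
Lemma circuit_return A c l E : circuit K A c l -> E \in c ->
  exists s, [/\ path (Defs.arc K A) E (rcons s E), size (rcons s E) = l &
                c =i rcons s E].
Proof.
move=> [_ /andP[cc _] <-] /rot_to[i s cs]. exists s; split.
- by move: cc; rewrite -(rot_cycle i (Defs.arc K A) c) cs.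
- by move/(congr1 size): cs; rewrite size_rot size_rcons => ->.
- by move=> F; rewrite -(mem_rot i c) cs mem_rcons.
Qed.

(** The entries of [c] are bare sets; the arc leaving [E] supplies an extreme generator. *)
Lemma circuit_extreme A c l E : circuit K A c l -> E \in c ->
  exists2 y, extreme_vector K y & E = Phi K y.
Proof.
move=> hc Ec; have [[|F s] [hp _ _]] := circuit_return hc Ec;
  by case/andP: hp => /arcP[y [_ [ey _ -> _ _]]] _; exists y.
Qed.

Lemma circuit_dominated A c l y : cone_preserving K A -> circuit K A c l ->
  K y -> Phi K y \in c -> dominated y (A ^+ l *m y).
Proof.
move=> hA hc Ky yc; have [s [hs <- _]] := circuit_return hc yc.
by apply: walk_dominated => //; rewrite last_rcons.
Qed.

Lemma circuit_walk_dominated A c l y u : cone_preserving K A ->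
  circuit K A c l -> K y -> Phi K y \in c -> Phi K u \in c ->
  exists j, dominated u (A ^+ j *m y).
Proof.
move=> hA hc Ky yc uc; have [s [hs _ cs]] := circuit_return hc yc.
(* The closed walk from the ray of [y] is cut where it meets the ray of [u]. *)
move: uc; rewrite cs => /path.splitP hsp; case: hsp hs => p1 p2.
rewrite cat_path => /andP[hp1 _]; exists (size (rcons p1 (Phi K u))).
by apply: walk_dominated => //; rewrite last_rcons.
Qed.

Lemma interior_exp_le A u k j y : cone_preserving K A -> K u ->
  (0 < k)%N -> interior K (A ^+ k *m u) -> (k <= j)%N ->
  interior K (A ^+ k *m y) -> interior K (A ^+ j *m y).
Proof.
move=> hA Ku k0 iu /subnK <- iy; elim: (j - k)%N => // d IH.
rewrite addSn -(add1n (d + k)) mulmx_exprD expr1.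
(* As [k] is positive, [A ^+ k.-1 *m u] is a vector of [K] that [A] sends into the interior, so [A]
   preserves interior vectors. *)
apply: (@interior_mulmx A (A ^+ k.-1 *m u)) IH => //.
  exact: cone_preserving_exp.
by rewrite mulmxA mulmxE -exprS prednK.
Qed.

(** * Bounds on the local exponent from interior iterates *)

Lemma local_exponent_le A x k : interior K (A ^+ k *m x) ->
  exists2 g, local_exponent K A x = Some g & (g <= k)%N.
Proof.
move=> ik; rewrite /local_exponent; case: pselect => [h|[]]; last first.
  by exists k; apply/asboolP.
by exists (ex_minn h) => //; case: ex_minnP => g _; apply; apply/asboolP.
Qed.

Lemma local_exponent_finite A x : local_exponent K A x <> None ->
  exists k, interior K (A ^+ k *m x).
Proof.
by rewrite /local_exponent; case: pselect => // -[k /asboolP ik] _; exists k.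
Qed.

End Domination.

Theorem lemma3p1 (R : realType) (n : nat) (K : set 'cV[R]_n.+1) (A : 'M[R]_n.+1)
    (x : 'cV[R]_n.+1) (c : seq (set 'cV[R]_n.+1)) (w l : nat)
    (hK : proper_cone K) (hA : cone_preserving K A)
    (hx : extreme_vector K x)
    (hc : circuit K A c l)
    (hw : distance_to_circuit K A c (Phi K x) w)
    (hirr : K_irreducible K (A ^+ l) \/
            exists u, [/\ extreme_vector K u, Phi K u \in c &
                          local_exponent K A u <> None]) :
  exists2 g, local_exponent K A x = Some g &
    [/\ (g <= w + (degree_mxminpoly (A ^+ l) - 1) * l)%N,
        (w + (degree_mxminpoly (A ^+ l) - 1) * l
           <= w + (degree_mxminpoly A - 1) * l)%N &
        (w + (degree_mxminpoly A - 1) * l <= w + (n.+1 - 1) * l)%N].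
Proof.
have [_ coneK _ intK] := hK; have [Kx _ _] := hx.
have [[p [hp pw pc]] _] := hw.
have [y [Ky y0 _] yE] := circuit_extreme hc pc.
have yx := walk_dominated coneK hA Kx hp yE.
rewrite pw in yx; rewrite yE in pc.
have l0 : (0 < l)%N by case: hc => c0 _ <-; case: (c) c0.
set m := degree_mxminpoly (A ^+ l).
have iy : interior K ((A ^+ l) ^+ (m - 1) *m y).
  have yBy := circuit_dominated coneK hA hc Ky pc.
  apply: interior_last_power => //; first exact: cone_preserving_exp.
  case: hirr => [|[u [[Ku _ _] uc /local_exponent_finite[k ik]]]]; first by left.
  right; have [j uy] := circuit_walk_dominated coneK hA hc Ky pc uc.
  have uBu := circuit_dominated coneK hA hc Ku uc.
  have hAk i := @cone_preserving_exp R n K A i hA.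
  (* Going once more around the circuit makes the exponent positive. *)
  have iu : interior K (A ^+ (k + l) *m u).
    apply: (dominated_interior coneK ik); first exact: hAk.
    by rewrite mulmx_exprD; apply: dominated_mulmx.
  have kl0 : (0 < k + l)%N by rewrite addn_gt0 l0 orbT.
  have iyj : interior K (A ^+ (k + l) *m (A ^+ j *m y)).
    apply: (dominated_interior coneK iu); first exact/hAk/hAk.
    exact: dominated_mulmx.
  (* The exponent of [A] must be a multiple of [l]. Multiplying [k + l + j] by [l] gives one that,
     after removing [j], is still at least [k + l]; from there on the iterates of [A ^+ j *m y] stay
     interior. *)
  exists (k + l + j)%N; rewrite -exprM.
  have le1 : (k + l + j <= l * (k + l + j))%N by rewrite leq_pmull.
  rewrite -(subnK (leq_trans (leq_addl (k + l) j) le1)) mulmx_exprD.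
  apply: (interior_exp_le coneK hA Ku kl0 iu) => //.
  by rewrite leq_subRL ?(leq_trans (leq_addl (k + l) j) le1) // addnC.
have ix : interior K (A ^+ (w + (m - 1) * l) *m x).
  apply: (dominated_interior coneK iy).
    exact: cone_preserving_exp.
  (* The [w] steps of the walk act first: [y] is below [A ^+ w *m x], and applying
     [(A ^+ l) ^+ (m - 1)] keeps the order. *)
  rewrite addnC mulmx_exprD mulnC exprM.
  by apply: dominated_mulmx yx; do 2!apply: cone_preserving_exp.
have [g -> gle] := local_exponent_le ix.
exists g => //; split=> //; rewrite leq_add2l leq_mul2r leq_sub2r ?orbT //.
  exact: degree_mxminpoly_expr.
exact: degree_mxminpoly_le.
Qed.
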